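(* Fix $\alpha\in\mathbb{R}$ and let $\epsilon=\epsilon_R>0$ be a function of $R>0$ such that $\epsilon R\to\infty$ as $R\to\infty$. Then, as $R\to\infty$, $$S_\alpha(\epsilon,R)=\mathrm{Area}(\mathrm{Sect}_{\alpha,\epsilon}(R))+O(R).$$
   Context: For $\alpha\in\mathbb{R}$, $\epsilon>0$, $R>0$ define the sector $$\mathrm{Sect}_{\alpha,\epsilon}(R):=\{(x,y)\in\mathbb{R}_{>0}\times\mathbb{R}:\ x^2+y^2\le R^2,\ \alpha-\epsilon<y/x<\alpha+\epsilon\},$$ whose area is $\mathrm{Area}(\mathrm{Sect}_{\alpha,\epsilon}(R))=\frac{R^2}{2}\left(\tan^{-1}(\alpha+\epsilon)-\tan^{-1}(\alpha-\epsilon)\right)$, and let $$S_\alpha(\epsilon,R):=\#\left(\mathbb{Z}^2\cap \mathrm{Sect}_{\alpha,\epsilon}(R)\right)=\#\{(m,n)\in\mathbb{Z}_{>0}\times\mathbb{Z}: m^2+n^2\le R^2,\ |n-\alpha m|<m\epsilon\}.$$ The quantity $\epsilon=\epsilon_R$ is viewed as a function of $R$. The $O$-notation refers to the limit $R\to\infty$ with $\alpha$ and the function $R\mapsto\epsilon_R$ fixed: the bound holds for all sufficiently large $R$ with an implied constant not depending on $R$. *)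

(* Defs.v *)
From HB Require Import structures.
From mathcomp Require Import all_boot all_order all_algebra.
From mathcomp Require Import finmap.
From mathcomp Require Import all_classical all_reals all_analysis.

Set Implicit Arguments.
Unset Strict Implicit.
Unset Printing Implicit Defensive.

Import Order.TTheory GRing.Theory Num.Theory.
Import numFieldNormedType.Exports.

Local Open Scope classical_set_scope.
Local Open Scope ring_scope.

Definition Sect (R : realType) (alpha eps r : R) : set (R * R) :=
  [set p | [/\ 0 < p.1, p.1 ^+ 2 + p.2 ^+ 2 <= r ^+ 2
             & alpha - eps < p.2 / p.1 < alpha + eps]].

(* Planar Lebesgue measure.  It is finite on [Sect alpha eps r], which is
   bounded, so [fine] does not discard an infinite value. *)
Definition area (R : realType) (A : set (R * R)) : R :=
  fine ((@lebesgue_measure R \x @lebesgue_measure R)%E A).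

Definition lattice_points (R : realType) (A : set (R * R)) : set (int * int) :=
  [set z | A (z.1%:~R, z.2%:~R)].

(* [fset_set] is a junk value on infinite sets only; a bounded region such as
   [Sect alpha eps r] has finitely many lattice points. *)
Definition sector_count (R : realType) (alpha eps r : R) : nat :=
  #|` fset_set (lattice_points (Sect alpha eps r)) |%fset.

(* Main.v *)
Require Import Defs.
From HB Require Import structures.
From mathcomp Require Import all_boot all_order all_algebra.
From mathcomp Require Import finmap.
From mathcomp Require Import all_classical all_reals all_analysis.
From mathcomp Require Import measurable_realfun.
From mathcomp Require Import zify ring lra.

Set Implicit Arguments.
Unset Strict Implicit.
Unset Printing Implicit Defensive.

Import Order.TTheory GRing.Theory Num.Theory.
Import numFieldNormedType.Exports.

Local Open Scope classical_set_scope.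
Local Open Scope ring_scope.

(** The sector is convex, so each vertical line x = const meets it in an
    interval; put len x for the length of that interval.

    By the definition of the product measure, the area is the integral of len
    over ]0, N] for any integer N >= r.  On the other hand an interval of length
    d contains d + O(1) integers, so summing over the columns x = 1, .., N gives
    len 1 + .. + len N + O(N) lattice points ([card_lattice_columns]).  With N
    the least integer above r, the error is O(r).

    It remains to compare the integral of len with its Riemann sum of step 1;
    these differ by at most the total variation of len on [0, N]
    ([abs_Rintegral_sub_sum_le]).  Let s x be the half-chord sqrt (r^2 - x^2).
    The slice at x is the intersection of ]a x, b x[ with [- s x, s x], where
    a = alpha - eps and b = alpha + eps, so len is the difference of the
    truncations of b x and of a x to [- s x, s x].  The truncation of c x follows
    a ray until it leaves the disc, and from there on the circle; up to sign it
    increases from 0 to at most r and then decreases back to 0, hence has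
    variation at most 2 r ([clip_variation_bound], [clip_variation_total]).
    So len has variation at most 4 r, uniformly in alpha and eps. *)

(** * Intervals, Riemann sums and lattice points in columns *)

(** Membership of the two endpoints is left open, so that a slice of the sector
    need not be described exactly. *)
Lemma measure_between_itv (R : realType) (l u : R) (A : set R) : l <= u ->
  (forall y, l < y < u -> A y) -> (forall y, A y -> l <= y <= u) ->
  (@lebesgue_measure R) A = (u - l)%:E.
Proof.
move=> lu inA outA; apply/eqP.
have mA : measurable A.
  have -> : A = `]l, u[ `|` (A `&` [set l; u]).
    apply/seteqP; split => [y Ay|y [|[]//]]; last first.
      by rewrite /= in_itv /= => /inA.
    have /andP[] := outA _ Ay.
    rewrite le_eqVlt => /predU1P[ly _|ly]; first by right; split => //; left.
    rewrite le_eqVlt => /predU1P[yu|yu]; first by right; split => //; right.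
    by left; rewrite /= in_itv /= ly yu.
  apply: measurableU; first exact: measurable_itv.
  apply: countable_measurable => //.
  exact/finite_set_countable/(sub_finite_set (@subIsetr _ _ _)).
rewrite eq_le; apply/andP; split.
  have -> : (u - l)%:E = @lebesgue_measure R `[l, u].
    rewrite lebesgue_measure_itv /= lte_fin; case: ltgtP lu => // -> _.
    by rewrite subrr.
  apply: le_measure; rewrite ?inE //.
have -> : (u - l)%:E = @lebesgue_measure R `]l, u[.
  rewrite lebesgue_measure_itv /= lte_fin; case: ltgtP lu => // -> _.
  by rewrite subrr.
apply: le_measure; rewrite ?inE //.
Qed.

(** On ]n, n + 1] the integrand differs from its value at n + 1 by at most the
    increment of V, and these increments telescope. *)
Lemma abs_Rintegral_sub_sum_le (R : realType) (h V : R -> R) (N : nat) :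
  measurable_fun setT h ->
  (forall x y, 0 <= x -> x <= y -> `|h x - h y| <= V y - V x) ->
  `|\int[@lebesgue_measure R]_(x in `]0, N%:R]) h x
    - \sum_(1 <= m < N.+1) h m%:R| <= V N%:R - V 0.
Proof.
move=> mh hV.
have V_le x y : 0 <= x -> x <= y -> V x <= V y.
  by move=> x0 xy; rewrite -subr_ge0 (le_trans _ (hV _ _ x0 xy)).
have inth (a b : R) : 0 <= a -> a <= b ->
    (@lebesgue_measure R).-integrable `]a, b] (EFin \o h).
  move=> a0 ab; apply: measurable_bounded_integrable => //.
  - rewrite /= lebesgue_measure_itv /=.
    by case: ifP => // _; rewrite -EFinB ltry.
  - exact: measurable_funS mh.
  exists (`|h b| + V b - V a); split; first exact: num_real.
  move=> M ltM x; rewrite /= in_itv /= => /andP[/ltW ax xb].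
  apply: le_trans (ltW ltM).
  have := hV x b (le_trans a0 ax) xb; have := V_le a x a0 ax.
  have := ler_normD (h x - h b) (h b); rewrite subrK; lra.
have cell (n : nat) :
    `|\int[@lebesgue_measure R]_(x in `]n%:R, n.+1%:R]) h x - h n.+1%:R|
      <= V n.+1%:R - V n%:R.
  have n0 : 0 <= n%:R :> R by [].
  have nn1 : n%:R <= n.+1%:R :> R by rewrite ler_nat.
  have intc (k : R) :
      (@lebesgue_measure R).-integrable `]n%:R, n.+1%:R] (EFin \o cst k).
    apply: measurable_bounded_integrable => //.
      rewrite /= lebesgue_measure_itv /=.
      by case: ifP => // _; rewrite -EFinB ltry.
    exists `|k|; split; first exact: num_real.
    by move=> M ltM x _ /=; exact: ltW.
  have Ec (k : R) : \int[@lebesgue_measure R]_(_ in `]n%:R, n.+1%:R]) k = k.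
    rewrite Rintegral_cst //= lebesgue_measure_itv /= lte_fin ltr_nat ltnSn.
    by rewrite -EFinB /= -natrB // subSnn mulr1.
  have bnd x : `]n%:R, n.+1%:R]%classic x ->
      `|h x - h n.+1%:R| <= V n.+1%:R - V n%:R.
    rewrite /= in_itv /= => /andP[/ltW nx xn].
    have := hV x n.+1%:R (le_trans n0 nx) xn; have := V_le _ _ n0 nx; lra.
  have lo : h n.+1%:R - (V n.+1%:R - V n%:R) <=
      \int[@lebesgue_measure R]_(x in `]n%:R, n.+1%:R]) h x.
    rewrite -[leLHS]Ec; apply: le_Rintegral => //; [exact: intc|exact: inth|].
    by move=> x /bnd; rewrite ler_norml; lra.
  have hi : \int[@lebesgue_measure R]_(x in `]n%:R, n.+1%:R]) h x <=
      h n.+1%:R + (V n.+1%:R - V n%:R).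
    rewrite -[leRHS]Ec; apply: le_Rintegral => //; [exact: inth|exact: intc|].
    by move=> x /bnd; rewrite ler_norml; lra.
  by rewrite ler_norml; lra.
elim: N => [|N IHN].
  by rewrite set_itvoc0 Rintegral_set0 big_geq // !subrr normr0.
have := @Rintegral_itvB R h (BRight 0) (BRight N.+1%:R) N%:R
  (inth _ _ (lexx _) (ler0n _ _)).
rewrite !bnd_simp ler0n ler_nat leqnSn => /(_ isT isT) splitN.
rewrite big_nat_recr //=; have := cell N; have := IHN.
rewrite -splitN !ler_norml; lra.
Qed.

Section LatticeColumns.
Variables (R : realType) (A : set (int * int)) (N : nat) (lo hi : nat -> R).
Hypothesis lo_hi : forall m, lo m <= hi m.
Hypothesis A_sub : forall (m n : int), A (m, n) ->
  exists2 k : nat, (0 < k <= N)%N /\ m = k & lo k <= n%:~R <= hi k.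
Hypothesis sub_A : forall (k : nat) (n : int), (0 < k <= N)%N ->
  lo k < n%:~R < hi k -> A (Posz k, n).

Let columns (start : nat -> int) (len : nat -> nat) : seq (int * int) :=
  [seq (Posz k, start k + Posz j) | k <- iota 1 N, j <- iota 0 (len k)].

Let size_columns start len : size (columns start len) =
  (\sum_(1 <= k < N.+1) len k)%N.
Proof.
rewrite size_allpairs_dep sumnE big_map /index_iota subn1.
by apply: eq_bigr => k _; rewrite size_iota.
Qed.

Let uniq_columns start len : uniq (columns start len).
Proof.
apply: allpairs_uniq_dep => [|k _|]; [exact: iota_uniq..|].
by move=> [k j] [k' j'] _ _ /= [-> /addrI[->]].
Qed.

(* These cover the integers of [lo k, hi k], possibly with one above hi k. *)
Let start_max k := Num.ceil (lo k).
Let len_max k := (Num.truncn (hi k - lo k)).+1.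
(* Here all points satisfy lo k < n < hi k: n is at most lo k + 1 + j, and
   j + 1 < hi k - lo k; the count is at least hi k - lo k - 1. *)
Let start_min k : int := Num.floor (lo k) + 1.
Let len_min k := (`|Num.ceil (hi k - lo k)|%N).-1.

Let ceil_len_ge0 k : 0 <= Num.ceil (hi k - lo k).
Proof. by rewrite ceil_ge0; have := lo_hi k; lra. Qed.

Let sub_columns z : A z -> z \in columns start_max len_max.
Proof.
case: z => m n /A_sub[k [kN ->] /andP[lon nhi]].
have cn : Num.ceil (lo k) <= n by rewrite ceil_le_int.
apply/allpairsPdep; exists k, `|n - Num.ceil (lo k)|%N; split.
- by rewrite mem_iota; lia.
- rewrite mem_iota /= add0n ltnS truncn_ge_nat ?subr_ge0 //.
  rewrite natr_absz ger0_norm ?subr_ge0 // rmorphB /=.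
  have := ceil_ge (lo k); lra.
- by congr (_, _); rewrite gez0_abs ?subr_ge0 // addrCA subrr addr0.
Qed.

Let columns_sub z : z \in columns start_min len_min -> A z.
Proof.
move=> /allpairsPdep[k [j [kI jI ->]]]; apply: sub_A.
  by move: kI; rewrite mem_iota; lia.
have : (Posz j.+1) < Num.ceil (hi k - lo k).
  by have := ceil_len_ge0 k; move: jI; rewrite mem_iota /len_min; lia.
rewrite ceil_gt_int -pmulrn -natr1.
have := floor_le (lo k); have := floorD1_gt (lo k).
rewrite /start_min !rmorphD /= -!pmulrn.
have := ler0n R j; lra.
Qed.

Let finite_A : finite_set A.
Proof. exact: sub_finite_set sub_columns (finite_seq _). Qed.

(** A closed interval of length d contains at most d + 1 integers, and its
    interior at least d - 1. *)
Lemma card_lattice_columns :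
  `|(#|` fset_set A|%fset)%:R - \sum_(1 <= k < N.+1) (hi k - lo k)|
    <= N%:R :> R.
Proof.
have N1 : N%:R = \sum_(1 <= k < N.+1) 1 :> R.
  by rewrite big_const_nat subSS subn0 iter_addr addr0.
rewrite ler_distl; apply/andP; split.
  rewrite N1 -sumrB;
    apply: (le_trans (y := (size (columns start_min len_min))%:R)).
    rewrite size_columns natr_sum; apply: ler_sum => k _.
    have := ceil_ge (hi k - lo k).
    have := ceil_len_ge0 k; rewrite /len_min.
    case: (Num.ceil _) => // - [|c] _ /=.
      by rewrite -[_%:~R]/(0 : R); lra.
    by rewrite -[_%:~R]/(c.+1%:R : R) -natr1; lra.
  rewrite ler_nat; apply: uniq_leq_size => // z /columns_sub Az.
  by rewrite in_fset_set // inE.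
rewrite N1 -big_split /=;
  apply: (le_trans (y := (size (columns start_max len_max))%:R)).
  rewrite ler_nat; apply: uniq_leq_size => [|z]; first exact: fset_uniq.
  by rewrite in_fset_set // inE => /sub_columns.
rewrite size_columns natr_sum; apply: ler_sum => k _.
by rewrite -natr1 lerD2r truncn_le subr_ge0.
Qed.
End LatticeColumns.

(** * Slices of the sector *)

(** Half the length of the vertical chord of the disc of radius r at abscissa x;
    it is 0 for x > r >= 0, because Num.sqrt vanishes on negative numbers. *)
Definition chord (R : realType) (r x : R) : R := Num.sqrt (r ^+ 2 - x ^+ 2).

(** The truncation of c x to the chord [- chord r x, chord r x].  Truncating both
    bounding lines makes the slice length clip r b x - clip r a x also when the
    slice is empty. *)
Definition clip (R : realType) (r c x : R) : R :=
  Num.max (- chord r x) (Num.min (c * x) (chord r x)).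

Section Clip.
Variables (R : realType) (r : R).

Lemma chord_ge0 (x : R) : 0 <= chord r x. Proof. exact: sqrtr_ge0. Qed.

Lemma chord_le (x y : R) : 0 <= x -> x <= y -> chord r y <= chord r x.
Proof.
by move=> x0 xy; rewrite ler_wsqrtr // lerD2l lerN2 lerXn2r // nnegrE; lra.
Qed.

Lemma chord_le_radius (x : R) : 0 <= r -> chord r x <= r.
Proof.
move=> r0; rewrite -[leRHS]ger0_norm // -sqrtr_sqr ler_wsqrtr //.
by rewrite gerBl sqr_ge0.
Qed.

Lemma Sect_slice_sub (a e x y : R) : 0 < x -> Sect a e r (x, y) ->
  clip r (a - e) x <= y <= clip r (a + e) x.
Proof.
move=> x0 [/= _ disc]; rewrite ltr_pdivlMr // ltr_pdivrMr // => /andP[ya yb].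
have : `|y| <= chord r x by rewrite -sqrtr_sqr ler_wsqrtr //; lra.
rewrite ler_norml => /andP[ys1 ys2].
by rewrite /clip ge_max le_max ge_min le_min ys1 ys2 (ltW ya) (ltW yb) orbT.
Qed.

Lemma sub_Sect_slice (a e x y : R) : 0 < x ->
  clip r (a - e) x < y < clip r (a + e) x -> Sect a e r (x, y).
Proof.
move=> x0; rewrite /clip gt_max lt_max gt_min lt_min.
move=> /andP[/andP[sy /orP ya] /orP yb].
have ys : y < chord r x by case: yb => [|/andP[]//]; have := chord_ge0 x; lra.
have ltys : `|y| < chord r x by rewrite ltr_norml sy ys.
have s0 : 0 < chord r x by apply: le_lt_trans ltys.
have d0 : 0 < r ^+ 2 - x ^+ 2 by rewrite -sqrtr_gt0.
split => //=.
  have : `|y| ^+ 2 <= chord r x ^+ 2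
    by rewrite lerXn2r ?nnegrE ?chord_ge0 // ltW.
  by rewrite real_normK ?num_real // sqr_sqrtr; lra.
rewrite ltr_pdivlMr // ltr_pdivrMr //; apply/andP; split.
  by case: ya => //; lra.
by case: yb => [|/andP[]//]; lra.
Qed.

Lemma clip_le (c d x : R) : 0 <= x -> c <= d -> clip r c x <= clip r d x.
Proof.
move=> x0 cd; have := ler_wpM2r x0 cd; rewrite /clip.
by move: (c * x) (d * x) (chord r x) => u v s; case: (leP u s); case: (leP v s);
  rewrite /Num.max; do ?case: ifP; lra.
Qed.

Lemma clipN (c x : R) : clip r (- c) x = - clip r c x.
Proof.
rewrite /clip mulNr; have := chord_ge0 x; move: (c * x) (chord r x) => u s s0.
by rewrite /Num.max /Num.min; do ?case: ifP; lra.
Qed.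

Lemma measurable_clip (c : R) : measurable_fun setT (clip r c).
Proof.
have ms : measurable_fun setT (chord r).
  have msqrt : measurable_fun setT (@Num.sqrt R).
    by apply: continuous_measurable_fun; exact: sqrt_continuous.
  apply: (measurableT_comp msqrt).
  by apply: measurable_funB => //; exact: measurable_funX.
apply: measurable_maxr; first exact: measurableT_comp.
by apply: measurable_minr => //; exact: measurable_funM.
Qed.

(** The abscissa where the line of slope c leaves the disc. *)
Definition clip_peak (c : R) : R := r / Num.sqrt (1 + c ^+ 2).

(** Up to an additive constant, the variation function of clip r c: it grows like
    |c| x before the peak and like - chord r x after it, the other term being
    frozen at its value at the peak. *)
Definition clip_variation (c x : R) : R :=
  `|c| * Num.min x (clip_peak c) - chord r (Num.max x (clip_peak c)).

Lemma chord_peak (c : R) : 0 <= r -> chord r (clip_peak c) = `|c| * clip_peak c.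
Proof.
move=> r0.
have q0 : 0 < 1 + c ^+ 2 by have := sqr_ge0 c; lra.
have -> : `|c| * clip_peak c = `|c * clip_peak c|.
  by rewrite normrM (ger0_norm (x := clip_peak c)) // divr_ge0 ?sqrtr_ge0.
rewrite -sqrtr_sqr /chord; congr Num.sqrt.
have E : clip_peak c ^+ 2 = r ^+ 2 / (1 + c ^+ 2).
  by rewrite /clip_peak expr_div_n sqr_sqrtr ?ltW.
rewrite [in RHS]exprMn E.
by field; rewrite gt_eqF.
Qed.

(** The two sides are equal when x and y are on the same side of the peak.
    Otherwise the rise up to the peak and the fall after it partly cancel. *)
Lemma clip_variation_bound (c x y : R) : 0 <= r -> 0 <= x -> x <= y ->
  `|clip r c x - clip r c y| <= clip_variation c y - clip_variation c x.
Proof.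
move=> r0 x0 xy.
wlog c0 : c / 0 <= c.
  move=> H; have [/H//|/ltW c0] := leP 0 c.
  have := H (- c); rewrite oppr_ge0 => /(_ c0).
  by rewrite !clipN -opprD normrN /clip_variation /clip_peak sqrrN normrN; apply.
rewrite /clip_variation (ger0_norm c0).
have p0 : 0 <= clip_peak c by rewrite divr_ge0 ?sqrtr_ge0.
have Ep := chord_peak c r0; rewrite ger0_norm // in Ep.
have before z : 0 <= z -> z <= clip_peak c -> clip r c z = c * z.
  move=> z0 zp; have zs : c * z <= chord r z.
    by have := chord_le z0 zp; have := ler_wpM2l c0 zp; lra.
  rewrite /clip (min_idPl zs); apply/max_idPr.
  by have := mulr_ge0 c0 z0; have := chord_ge0 z; lra.
have after z : clip_peak c <= z -> clip r c z = chord r z.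
  move=> pz; have zs : chord r z <= c * z.
    by have := chord_le p0 pz; have := ler_wpM2l c0 pz; lra.
  rewrite /clip (min_idPr zs); apply/max_idPr.
  by have := chord_ge0 z; lra.
have [yp|/ltW py] := leP y (clip_peak c).
  have xp : x <= clip_peak c by lra.
  have y0 : 0 <= y by lra.
  rewrite (before x) // (before y) //.
  by rewrite (min_idPl xp) (max_idPr xp) ler_norml;
    have := ler_wpM2l c0 xy; lra.
have [xp|/ltW px] := leP x (clip_peak c).
  rewrite (before x) // (after y) //.
  have := chord_le p0 py; have := ler_wpM2l c0 xp; rewrite ler_norml; lra.
rewrite (after x) // (after y) //.
by rewrite ger0_norm ?subr_ge0 ?chord_le //; lra.
Qed.

Lemma clip_variation_total (c y : R) : 0 <= r ->
  clip_variation c y - clip_variation c 0 <= 2 * r.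
Proof.
move=> r0; rewrite /clip_variation.
have p0 : 0 <= clip_peak c by rewrite divr_ge0 ?sqrtr_ge0.
have := chord_peak c r0; have := chord_le_radius (clip_peak c) r0.
rewrite (min_idPl p0) (max_idPr p0) mulr0.
have := chord_ge0 (Num.max y (clip_peak c)).
have : `|c| * Num.min y (clip_peak c) <= `|c| * clip_peak c.
  by rewrite ler_wpM2l // ge_min lexx orbT.
lra.
Qed.
End Clip.

(** * Area of the sector, and the lattice point count *)

Lemma area_Sect (R : realType) (a e r : R) (N : nat) :
  0 < e -> 0 <= r -> r <= N%:R ->
  area (Sect a e r) = \int[@lebesgue_measure R]_(x in `]0, N%:R])
                        (clip r (a + e) x - clip r (a - e) x).
Proof.
move=> e0 r0 rN; rewrite /area /product_measure1 /Rintegral; congr fine.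
rewrite [RHS]integral_mkcond; apply: eq_integral => x _ /=.
rewrite patchE; case: ifPn; rewrite ?inE ?notin_setE /= in_itv /=.
  move=> /andP[x0 _]; apply: measure_between_itv.
  - by apply: clip_le; lra.
  - by move=> y /(sub_Sect_slice x0) Sy; apply/xsectionP.
  - by move=> y /xsectionP; exact: Sect_slice_sub.
move=> xN; rewrite (_ : xsection _ _ = set0) ?measure0 //.
apply/seteqP; split => // y /xsectionP[/= x0 disc _]; apply: xN.
rewrite x0 (le_trans _ rN) //.
rewrite -(@ler_pXn2r _ 2) // ?nnegrE; [|lra..].
by have := sqr_ge0 y; lra.
Qed.

Theorem theorem1p1 (R : realType) (alpha : R) (eps : R -> R)
    (eps_gt0 : forall r : R, 0 < r -> 0 < eps r)
    (epsR_infty : eps r * r @[r --> +oo] --> +oo) :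
  exists2 C : R, 0 < C &
    \forall r \near +oo,
      `|(sector_count alpha (eps r) r)%:R - area (Sect alpha (eps r) r)| <= C * r.
Proof.
(* 4 r for the variation of the slice length, and N <= r + 1 <= 2 r for the
   rounding in the columns *)
exists 6 => //.
near=> r.
have r1 : 1 <= r by near: r; apply: nbhs_pinfty_ge; exact: num_real.
have r0 : 0 <= r by lra.
have e0 : 0 < eps r by apply: eps_gt0; lra.
move: (eps r) e0 => e e0 {eps eps_gt0 epsR_infty}.
set N := (Num.truncn r).+1.
have rN : r <= N%:R by exact/ltW/truncnS_gt.
have Nr : N%:R <= r + 1 by rewrite -natr1 lerD2r truncn_le.
pose len x := clip r (alpha + e) x - clip r (alpha - e) x.
pose V x := clip_variation r (alpha + e) x + clip_variation r (alpha - e) x.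
have count :
    `|(sector_count alpha e r)%:R - \sum_(1 <= m < N.+1) len m%:R| <= N%:R.
  apply: (@card_lattice_columns _ _ _ (fun m => clip r (alpha - e) m%:R)
                                      (fun m => clip r (alpha + e) m%:R)).
  - by move=> m; apply: clip_le => //; lra.
  - move=> m n Smn; have := Smn.
    case=> /=; rewrite ltr0z => m0 disc _.
    case: m m0 Smn disc => // k k0 Skn disc.
    exists k; last by apply: Sect_slice_sub Skn; rewrite ltr0n.
    split=> //; apply/andP; split=> //.
    apply: (leq_trans (n := Num.truncn r)) => //.
    rewrite truncn_ge_nat // -(@ler_pXn2r _ 2) // ?nnegrE //.
    by have := sqr_ge0 (n%:~R : R); move: disc; rewrite -pmulrn; lra.
  - by move=> k n /andP[k0 _]; apply: sub_Sect_slice; rewrite ltr0n.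
have integral := @abs_Rintegral_sub_sum_le R len V N.
have {integral} :
    `|area (Sect alpha e r) - \sum_(1 <= m < N.+1) len m%:R| <= V N%:R - V 0.
  rewrite (area_Sect alpha e0 r0 rN); apply: integral.
    by apply: measurable_funB; exact: measurable_clip.
  move=> x y x0 xy; rewrite /len /V.
  have := clip_variation_bound (alpha + e) r0 x0 xy.
  have := clip_variation_bound (alpha - e) r0 x0 xy.
  rewrite !ler_norml; lra.
have : V N%:R - V 0 <= 4 * r.
  have := clip_variation_total (alpha + e) N%:R r0.
  have := clip_variation_total (alpha - e) N%:R r0.
  rewrite /V; lra.
move: count; rewrite !ler_norml; lra.
Unshelve. all: by end_near.
Qed.
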